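(* Let $G = (I \cup C, E)$ be a split graph, where $I$ is an independent set and $C$ is an inclusion-wise maximal clique. Then $G$ is transitively orientable if and only if the vertices of $C$ can be labeled from $1$ to $k = |C|$ such that the following properties (i)–(v) hold: For $a, b \in I$, (i) The neighborhood $N(a)$ has one of the following forms: $[1, m] \cup [n, k]$ for $m < n$, $[1, r]$ for $r < k$, or $[l, k]$ for $l > 1$. (ii) If $N(a) = [1, r]$ and $N(b) = [l, k]$, for $r < k$ and $l > 1$, then $r < l$. (iii) If $N(a) = [1, m] \cup [n, k]$ and $N(b) = [1, r]$, for $r < k$ and $m < n$, then $r < n$. (iv) If $N(a) = [1, m] \cup [n, k]$ and $N(b) = [l, k]$, for $l > 1$ and $m < n$, then $m < l$. (v) If $N(a) = [1, m] \cup [n, k]$ and $N(b) = [1, m'] \cup [n', k]$, for $m < n$ and $m' < n'$, then $m < n'$ and $m' < n$.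
   Context: Graphs are simple. A graph is a split graph if its vertex set can be partitioned as $I \cup C$, where $I$ induces an independent set and $C$ induces a clique; $C$ is taken to be inclusion-wise maximal, i.e. no vertex of $I$ is adjacent to all vertices of $C$. An orientation of a graph is transitive if whenever $\overrightarrow{ab}$ and $\overrightarrow{bc}$ are arcs, $\overrightarrow{ac}$ is also an arc; a graph is transitively orientable (a comparability graph) if it admits a transitive orientation. $N(a)$ denotes the set of neighbors of $a$; for $a \in I$ it is a subset of $C$, and each vertex of $C$ is identified with its label in $\{1, \ldots, k\}$. For integers $a \le b$, $[a, b]$ denotes the set of integers $\{a, a+1, \ldots, b\}$; the notation is used only for $a \le b$.
   Formalization: Property (i) is required only of vertices a in I with N(a) nonempty, since an isolated vertex of I has none of the three forms (with nonempty intervals) yet does not affect transitive orientability; an edge plus an isolated vertex refutes the literal claim. *)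

(* Defs.v *)
From mathcomp Require Import all_boot.

Set Implicit Arguments.
Unset Strict Implicit.
Unset Printing Implicit Defensive.

(* A finite simple graph is a symmetric irreflexive [e : rel T] on a finType. *)
Section Graphs.
Variables (T : finType) (e : rel T).

Definition neighbors (x : T) : {set T} := [set y | e x y].

Definition independent (A : {set T}) : bool :=
  [forall x in A, forall y in A, ~~ e x y].

Definition clique (A : {set T}) : bool :=
  [forall x in A, forall y in A, (x != y) ==> e x y].

(* Either part may be empty. *)
Definition split_partition (I C : {set T}) : Prop :=
  [/\ I :|: C = [set: T], [disjoint I & C], independent I & maxset clique C].

(* [o x y] is the arc from [x] to [y]; [(+)] is exclusive or. *)
Definition orientation (o : rel T) : Prop :=
  (forall x y, o x y -> e x y) /\ (forall x y, e x y -> o x y (+) o y x).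

Definition transitively_orientable : Prop :=
  exists o : rel T, orientation o /\ transitive o.

End Graphs.

Section Labels.
Variables (T : finType) (e : rel T) (C : {set T}).

(* An injection of [C] into {1, ..., #|C|} is a bijection; the values of [lab]
   outside [C] are irrelevant. *)
Definition labeling (lab : T -> nat) : Prop :=
  {in C &, injective lab} /\ {in C, forall c, 1 <= lab c <= #|C|}.

Variable lab : T -> nat.

(* The integer interval [i, j], vertices of [C] being identified with labels. *)
Definition interval (i j : nat) : {set T} := [set c in C | i <= lab c <= j].

(* The three shapes of a neighborhood. The bounds [1 <= m], [n <= #|C|],
   [1 <= r] and [l <= #|C|] say that each interval [i, j] has i <= j. *)
Definition two_sided (m n : nat) (a : T) : Prop :=
  [/\ 1 <= m, m < n, n <= #|C|
    & neighbors e a = interval 1 m :|: interval n #|C|].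

Definition initial (r : nat) (a : T) : Prop :=
  [/\ 1 <= r, r < #|C| & neighbors e a = interval 1 r].

Definition final (l : nat) (a : T) : Prop :=
  [/\ 1 < l, l <= #|C| & neighbors e a = interval l #|C|].

(* None of the three shapes is empty, whereas isolated vertices of the
   independent part do not affect transitive orientability: the shape is to be
   required only of vertices having at least one neighbor. *)
Definition has_shape (a : T) : Prop :=
  [\/ exists m n, two_sided m n a, exists r, initial r a
    | exists l, final l a].

End Labels.

(* Main.v *)
Require Import Defs.
From mathcomp Require Import all_boot zify.

Set Implicit Arguments.
Unset Strict Implicit.
Unset Printing Implicit Defensive.

(** A transitive orientation restricts to a transitive tournament, that is, to a
    linear order, on the clique [C]; labelings of [C] are just such orders.
    Given the order, transitivity leaves no freedom for the edges at a vertex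
    [a] of [I].  If [c] points to [a], then so does every vertex below [c], and
    if [a] points to [c], then [a] points to every vertex above [c].  Hence the
    in-neighbors of [a] lie in [bottom a], the largest initial segment of [C]
    contained in [N(a)], and its out-neighbors in [top a], the largest final
    segment.  Because [C] is maximal, [N(a)] is not all of [C], so these two
    segments are disjoint and the inclusions are equalities.  A path from [a] to
    [b] through [c], with [a] and [b] in [I], would force an edge inside [I], so
    [top a] and [bottom b] never meet.

    Conversely, if every [N(a)] is the union of [bottom a] and [top a], and no
    bottom meets a top, then orienting [C] by the labels, [bottom a] towards [a]
    and [top a] away from [a] is transitive ([orientable_iff_segmented]).

    The five conditions spell out this criterion in terms of endpoints
    ([segmented_iff_shapes]).  The shapes say that a nonempty [N(a)] is a
    union of an initial and a final segment not covering [C]; the four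
    inequalities say that an initial segment [[1, r]] of one neighborhood and a
    final segment [[l, k]] of another satisfy [r < l], once for each combination
    of shapes providing [r] and [l]. *)

Section SplitGraph.
Variables (T : finType) (e : rel T) (I C : {set T}).
Hypotheses (e_sym : symmetric e) (e_irr : irreflexive e).
Hypothesis splitG : split_partition e I C.

(** * Split partitions *)

Lemma indep_nonadj a b : a \in I -> b \in I -> e a b = false.
Proof.
move=> aI bI; have [_ _ /'forall_implyP /(_ _ aI) /'forall_implyP indI _] := splitG.
exact/negbTE/indI.
Qed.

Lemma clique_adj x y : x \in C -> y \in C -> x != y -> e x y.
Proof.
move=> xC yC; have [_ _ _ /maxsetp /'forall_implyP /(_ _ xC)] := splitG.
by move/'forall_implyP => /(_ _ yC) /implyP.
Qed.

Lemma notin_clique x : (x \notin C) = (x \in I).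
Proof.
have [defT disIC _ _] := splitG; have := in_setT x; rewrite -defT inE.
by case: (boolP (x \in I)) => [/(disjointFr disIC) -> | _ /= ->].
Qed.

Lemma adj_indep_clique a x : a \in I -> e a x -> x \in C.
Proof.
by move=> aI; apply: contraTT; rewrite notin_clique => /(indep_nonadj aI) ->.
Qed.

Lemma ex_nonneighbor a : a \in I -> exists2 x, x \in C & ~~ e a x.
Proof.
move=> aI; have [_ disIC _ /maxsetP[_ maxC]] := splitG.
apply/exists_inP; apply: contraT => /exists_inPn full.
have adj x : x \in C -> e a x by move/full; rewrite negbK.
suff /maxC/(_ (subsetUr _ _)) defC : clique e (a |: C).
  by have := disjointFr disIC aI; rewrite -defC setU11.
apply/'forall_implyP => x /setU1P xU; apply/'forall_implyP => y /setU1P yU.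
apply/implyP => neq_xy.
case: xU yU neq_xy => [->|xC] [->|yC]; rewrite ?eqxx // => neq_xy.
- exact: adj.
- by rewrite e_sym adj.
- exact: clique_adj.
Qed.

(** * Labelings *)

(** The label of a vertex is its rank, counted from 1. *)
Lemma linear_order_labeling (o : rel T) :
    transitive o -> irreflexive o ->
    {in C &, forall x y, x != y -> o x y || o y x} ->
  exists2 lab, labeling C lab & {in C &, forall x y, o x y = (lab x < lab y)}.
Proof.
move=> o_tr o_irr o_tot.
pose lab c := #|[set x in C | (x == c) || o x c]|.
have lab_lt : {in C &, forall x y, o x y -> lab x < lab y}.
  move=> x y xC yC oxy; apply/proper_card/properP; split.
    apply/subsetP => z /[!inE] /andP[-> /predU1P[-> | ozx]]; rewrite ?oxy ?orbT //=.
    by rewrite (o_tr _ _ _ ozx oxy) orbT.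
  exists y; rewrite !inE yC ?eqxx //=; apply/norP; split.
    by apply: contraTneq oxy => ->; rewrite o_irr.
  by apply/negP => /(o_tr _ _ _ oxy); rewrite o_irr.
exists lab; first split.
- move=> x y xC yC eq_lab; apply/eqP; apply: contraT => /(o_tot _ _ xC yC).
  by case/orP => [/(lab_lt _ _ xC yC) | /(lab_lt _ _ yC xC)]; rewrite eq_lab ltnn.
- move=> c cC; apply/andP; split.
    by apply/card_gt0P; exists c; rewrite inE cC eqxx.
  by apply/subset_leq_card/subsetP => x /[!inE] /andP[].
move=> x y xC yC; apply/idP/idP => [/lab_lt -> // | lt_xy].
have /(o_tot _ _ xC yC) : x != y by apply: contraTneq lt_xy => ->; rewrite ltnn.
case/orP => // oyx.
by have := ltn_trans lt_xy (lab_lt _ _ yC xC oyx); rewrite ltnn.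
Qed.

Section Labeled.
Variable lab : T -> nat.
Hypothesis labC : labeling C lab.

Lemma label_inj : {in C &, injective lab}. Proof. by case: labC. Qed.

Lemma label_bounds c : c \in C -> 1 <= lab c <= #|C|.
Proof. by case: labC => _; apply. Qed.

Lemma ex_label l : 1 <= l <= #|C| -> exists2 c, c \in C & lab c = l.
Proof.
move=> l_bounds; pose s := [seq lab c | c in C].
have s_uniq : uniq s.
  by rewrite map_inj_in_uniq ?enum_uniq // => x y; rewrite !mem_enum; apply: label_inj.
have sub_s : {subset s <= iota 1 #|C|}.
  by move=> _ /imageP[c cC ->]; rewrite mem_iota add1n ltnS label_bounds.
have [|_ s_all] := uniq_min_size s_uniq sub_s.
  by rewrite size_iota size_image.
have /imageP[c cC ->] : l \in s by rewrite s_all mem_iota add1n ltnS.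
by exists c.
Qed.

Lemma in_interval i j c : (c \in interval C lab i j) = (c \in C) && (i <= lab c <= j).
Proof. by rewrite inE. Qed.

(** The empty downset is the case [m = 0], since labels start at 1. *)
Lemma downset_interval (S : {set T}) :
    S \subset C ->
    {in C & S, forall x c, lab x <= lab c -> x \in S} ->
  exists2 m, m <= #|C| & S = interval C lab 1 m.
Proof.
move=> /subsetP subSC downS; exists (\max_(c in S) lab c).
  by apply/bigmax_leqP => c /subSC /label_bounds /andP[].
apply/setP => x; rewrite in_interval; apply/idP/and3P => [xS | [xC lab_x le_x]].
  have xC := subSC x xS; split=> //; first by case/andP: (label_bounds xC).
  exact: leq_bigmax_cond.
have S_gt0 : 0 < #|S|.
  rewrite lt0n; apply: contraTneq le_x => /cards0_eq ->.
  by rewrite big_set0 -ltnNge.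
have [c cS defm] := eq_bigmax_cond lab S_gt0.
by apply: (downS x c) => //; rewrite -defm.
Qed.

(** Pass to the complement, a downset of [C]; the empty upset is the case [n = k + 1]. *)
Lemma upset_interval (S : {set T}) :
    S \subset C ->
    {in C & S, forall x c, lab c <= lab x -> x \in S} ->
  exists2 n, 1 <= n <= #|C|.+1 & S = interval C lab n #|C|.
Proof.
move=> subSC upS.
have [|x c xC|m le_mk defD] := @downset_interval (C :\: S).
- exact: subsetDl.
- rewrite !inE xC andbT => /andP[cNS cC] le_xc.
  by apply: contra cNS => xS; apply: (upS c x).
exists m.+1; first by rewrite ltnS.
apply/setP => x; have /setP/(_ x) := defD; rewrite in_setD !in_interval.
case: (boolP (x \in C)) => [/label_bounds | xNC _].
  by case: (x \in S) => /=; lia.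
by apply/negbTE; apply: contra xNC; apply/subsetP.
Qed.

(** * Bottom and top segments of a neighborhood *)

Definition bottom a : {set T} :=
  [set c in C | [forall x in C, (lab x <= lab c) ==> e a x]].

Definition top a : {set T} :=
  [set c in C | [forall x in C, (lab c <= lab x) ==> e a x]].

Lemma bottomP a c :
  reflect (c \in C /\ {in C, forall x, lab x <= lab c -> e a x}) (c \in bottom a).
Proof.
rewrite inE; apply: (iffP andP) => -[cC adj]; split=> //.
  by move=> x xC; apply/implyP; move: x xC; apply/'forall_implyP.
by apply/'forall_implyP => x xC; apply/implyP/adj.
Qed.

Lemma topP a c :
  reflect (c \in C /\ {in C, forall x, lab c <= lab x -> e a x}) (c \in top a).
Proof.
rewrite inE; apply: (iffP andP) => -[cC adj]; split=> //.
  by move=> x xC; apply/implyP; move: x xC; apply/'forall_implyP.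
by apply/'forall_implyP => x xC; apply/implyP/adj.
Qed.

Lemma bottom_down a x c :
  x \in C -> c \in bottom a -> lab x <= lab c -> x \in bottom a.
Proof.
move=> xC /bottomP[_ adj] le_xc; apply/bottomP; split=> // y yC le_yx.
exact: adj (leq_trans le_yx le_xc).
Qed.

Lemma top_up a x c :
  x \in C -> c \in top a -> lab c <= lab x -> x \in top a.
Proof.
move=> xC /topP[_ adj] le_cx; apply/topP; split=> // y yC le_xy.
exact: adj (leq_trans le_cx le_xy).
Qed.

(** Otherwise the two segments would cover [C], against the maximality of [C]. *)
Lemma bottom_lt_top a c d :
  a \in I -> c \in bottom a -> d \in top a -> lab c < lab d.
Proof.
move=> /ex_nonneighbor[x xC nadj] /bottomP[_ adjc] /topP[_ adjd].
rewrite ltnNge; apply: contra nadj => le_dc.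
by case: (leqP (lab x) (lab c)) => [|/ltnW/(leq_trans le_dc)]; [apply: adjc | apply: adjd].
Qed.

Definition segmented : Prop :=
  (forall a, a \in I -> neighbors e a \subset bottom a :|: top a) /\
  (forall a b c, a \in I -> b \in I -> c \in bottom a -> c \in top b -> False).

(** * Transitive orientations and bottom and top segments *)

Section Oriented.
Variable o : rel T.
Hypotheses (orient_o : orientation e o) (o_tr : transitive o).
Hypothesis o_lab : {in C &, forall x y, o x y = (lab x < lab y)}.

(** Every vertex [x] of [C] below [c] has the path from [x] to [a] through [c]. *)
Lemma arc_into_bottom a c : a \in I -> o c a -> c \in bottom a.
Proof.
move=> aI oca; have [sub_o _] := orient_o.
have cC : c \in C by apply: adj_indep_clique aI _; rewrite e_sym sub_o.
apply/bottomP; split=> // x xC; rewrite leq_eqVlt => /predU1P[eq_xc | lt_xc].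
  by rewrite (label_inj xC cC eq_xc) e_sym sub_o.
by rewrite e_sym sub_o // (o_tr _ oca) // o_lab.
Qed.

Lemma arc_from_top a c : a \in I -> o a c -> c \in top a.
Proof.
move=> aI oac; have [sub_o _] := orient_o.
have cC : c \in C by apply: adj_indep_clique aI _; rewrite sub_o.
apply/topP; split=> // x xC; rewrite leq_eqVlt => /predU1P[eq_cx | lt_cx].
  by rewrite -(label_inj cC xC eq_cx) sub_o.
by rewrite sub_o // (o_tr oac) // o_lab.
Qed.

Lemma orientation_segmented : segmented.
Proof.
have [sub_o xor_o] := orient_o.
have arc x y : e x y -> o x y || o y x by move/xor_o; do 2!case: (o _ _).
split=> [a aI | a b c aI bI cbot ctop].
  apply/subsetP => c; rewrite [_ \in neighbors _ _]inE => eac; apply/setUP.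
  by case/orP: (arc _ _ eac) => [/(arc_from_top aI) | /(arc_into_bottom aI)]; auto.
(* An edge from the bottom of [a] leaving [a] would put [c] into the top of [a]
   as well, and dually for [b]; so [b] points to [c] and [c] to [a]. *)
have oca : o c a.
  have /bottomP[cC adj] := cbot; case/orP: (arc _ _ (adj c cC (leqnn _))) => //.
  by move=> /(arc_from_top aI)/(bottom_lt_top aI cbot); rewrite ltnn.
have obc : o b c.
  have /topP[cC adj] := ctop; case/orP: (arc _ _ (adj c cC (leqnn _))) => //.
  by move=> /(arc_into_bottom bI)/(bottom_lt_top bI) /(_ ctop); rewrite ltnn.
by have := sub_o _ _ (o_tr obc oca); rewrite indep_nonadj.
Qed.

End Oriented.

Definition segment_orientation : rel T := fun x y =>
  if x \in C then if y \in C then lab x < lab y else x \in bottom y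
  else (y \in C) && (y \in top x).

Lemma segment_orientationP : segmented -> orientation e segment_orientation.
Proof.
case=> covered apart; rewrite /segment_orientation; split=> x y.
  case: ifP => xC; last first.
    by case/andP=> yC /topP[_]; apply.
  case: ifP => yC; last by rewrite e_sym => /bottomP[_]; apply.
  by move=> lt_xy; apply: clique_adj => //; apply: contraTneq lt_xy => ->; rewrite ltnn.
have mixed a c : a \in I -> e a c -> (c \in bottom a) (+) (c \in top a).
  move=> aI eac; have /subsetP/(_ c) := covered a aI.
  rewrite in_setU inE => /(_ eac); case: (boolP (c \in bottom a)) => // cbot _.
  by apply/negP; apply: apart cbot.
move=> exy; case: (boolP (x \in C)) => xC; case: (boolP (y \in C)) => yC /=.
- have neq_lab : lab x != lab y.
    by apply: contraTneq exy => /(label_inj xC yC) ->; rewrite e_irr.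
  by case: ltngtP neq_lab.
- by apply: mixed; rewrite -?notin_clique // e_sym.
- by rewrite addbC mixed // -notin_clique.
- by move: exy; rewrite indep_nonadj // -notin_clique.
Qed.

Lemma segment_orientation_trans : segmented -> transitive segment_orientation.
Proof.
case=> _ apart y x z; rewrite /segment_orientation.
case: (boolP (y \in C)) => [yC | /[!notin_clique] yI].
  case: (boolP (x \in C)) => [xC | /[!notin_clique] xI];
    case: (boolP (z \in C)) => [zC | /[!notin_clique] zI] /=.
  - exact: ltn_trans.
  - by move=> /ltnW le_xy /bottom_down; apply.
  - by move=> ytop /ltnW; apply: top_up.
  - by move=> ytop ybot; case: (apart z x y).
case: (x \in C) => //= xbot; case/andP=> -> ztop.
exact: bottom_lt_top xbot ztop.
Qed.

(** * Endpoints of segments *)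

Lemma interval_bottom a r c :
  interval C lab 1 r \subset neighbors e a -> c \in C -> lab c <= r ->
  c \in bottom a.
Proof.
move=> /subsetP sub cC le_cr; apply/bottomP; split=> // x xC le_xc.
have := sub x; rewrite !inE xC (leq_trans le_xc le_cr) andbT /=; apply.
by case/andP: (label_bounds xC).
Qed.

Lemma interval_top a l c :
  interval C lab l #|C| \subset neighbors e a -> c \in C -> l <= lab c ->
  c \in top a.
Proof.
move=> /subsetP sub cC le_lc; apply/topP; split=> // x xC le_cx.
have := sub x; rewrite !inE xC (leq_trans le_lc le_cx) /=; apply.
by case/andP: (label_bounds xC).
Qed.

Lemma segmented_shape a :
  segmented -> a \in I -> neighbors e a != set0 -> has_shape e C lab a.
Proof.
case=> covered _ aI nz.
have [|x c xC cbot|m le_mk defbot] := @downset_interval (bottom a).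
- by apply/subsetP => x /bottomP[].
- exact: bottom_down.
have [|x c xC ctop|n n_bounds deftop] := @upset_interval (top a).
- by apply/subsetP => x /topP[].
- exact: top_up.
have defN : neighbors e a = interval C lab 1 m :|: interval C lab n #|C|.
  apply/eqP; rewrite -defbot -deftop eqEsubset covered //=; apply/subsetP => x.
  by case/setUP => [/bottomP | /topP] [xC]; rewrite inE; apply.
have lt_mn : m < n.
  have [x xC] := ex_nonneighbor aI; have /setP/(_ x) := defN.
  by rewrite in_setU !in_interval inE xC => ->; have := label_bounds xC; lia.
(* The bottom is empty exactly for [m = 0], the top exactly for [n = k + 1]. *)
case: (posnP m) => [m0 | m_gt0].
  have bot0 : interval C lab 1 m = set0.
    by apply/setP => x; rewrite in_interval inE; case: (x \in C); lia.
  have le_nk : n <= #|C|.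
    case/set0Pn: nz => x; rewrite defN bot0 set0U in_interval.
    by case/and3P=> _; apply: leq_trans.
  apply: Or33; exists n; split=> //; last by rewrite defN bot0 set0U.
  have [x xC] := ex_nonneighbor aI; have /setP/(_ x) := defN.
  rewrite in_setU !in_interval inE xC => ->; have := label_bounds xC; lia.
case: (leqP n #|C|) => [le_nk | lt_kn]; first by apply: Or31; exists m, n.
have top0 : interval C lab n #|C| = set0.
  by apply/setP => x; rewrite in_interval inE; case: (x \in C); lia.
have {}defN : neighbors e a = interval C lab 1 m by rewrite defN top0 setU0.
apply: Or32; exists m; split=> //.
have [x xC] := ex_nonneighbor aI; have /setP/(_ x) := defN.
rewrite !in_interval inE xC => ->; have := label_bounds xC; lia.
Qed.

(** The common source of the four inequalities. *)
Lemma segmented_endpoints a b r l :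
    segmented -> a \in I -> b \in I -> r <= #|C| -> 1 <= l ->
    interval C lab 1 r \subset neighbors e a ->
    interval C lab l #|C| \subset neighbors e b ->
  r < l.
Proof.
case=> _ apart aI bI le_rk l_gt0 sub_a sub_b; rewrite ltnNge; apply/negP => le_lr.
have [|c cC defl] := @ex_label l; first by rewrite l_gt0 (leq_trans le_lr).
apply: (apart a b c) => //.
  by apply: interval_bottom sub_a _ _; rewrite ?defl.
by apply: interval_top sub_b _ _; rewrite ?defl.
Qed.

Lemma shape_segments a :
  has_shape e C lab a -> neighbors e a \subset bottom a :|: top a.
Proof.
move=> shape_a; apply/subsetP => c cN; apply/setUP.
case: shape_a => [[m [n [_ _ _ defN]]] | [r [_ _ defN]] | [l [_ _ defN]]];
  have := cN; rewrite {1}defN ?in_setU !in_interval.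
- case/orP => /and3P[cC lo hi]; [left | right].
    by apply: interval_bottom _ cC hi; rewrite defN subsetUl.
  by apply: interval_top _ cC lo; rewrite defN subsetUr.
- by case/and3P=> cC _ hi; left; apply: interval_bottom _ cC hi; rewrite defN.
- by case/and3P=> cC lo _; right; apply: interval_top _ cC lo; rewrite defN.
Qed.

(** In the two-sided case, if the bottom extended past [m], then the vertex
    labeled [m + 1] would lie in the other interval, and the two intervals would
    cover [C].  A vertex with a final neighborhood has an empty bottom, as it
    misses the vertex labeled 1. *)
Lemma bottom_endpoint a c :
    a \in I -> c \in bottom a -> has_shape e C lab a ->
  exists2 r, lab c <= r
    & initial e C lab r a \/ exists n, two_sided e C lab r n a.
Proof.
move=> aI cbot; have /bottomP[cC adj] := cbot; have c_bounds := label_bounds cC.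
case=> [[m [n shape_a]] | [r shape_a] | [l [l_gt1 _ defN]]].
- exists m; last by right; exists n.
  have [_ lt_mn le_nk defN] := shape_a.
  rewrite leqNgt; apply/negP => lt_mc.
  have [|d dC defd] := @ex_label m.+1; first lia.
  have [x xC nadj] := ex_nonneighbor aI.
  have /setP/(_ d) := defN; have /setP/(_ x) := defN; have := label_bounds xC.
  rewrite !in_setU !in_interval !inE xC dC defd (negbTE nadj) adj ?defd //; lia.
- exists r; last by left.
  have [_ _ defN] := shape_a.
  have /setP/(_ c) := defN; rewrite in_interval inE adj // cC => /esym; lia.
- have [|d dC defd] := @ex_label 1; first lia.
  have /setP/(_ d) := defN; rewrite in_interval inE adj ?dC ?defd; lia.
Qed.

Lemma top_endpoint b c :
    b \in I -> c \in top b -> has_shape e C lab b ->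
  exists2 l, l <= lab c
    & final e C lab l b \/ exists m, two_sided e C lab m l b.
Proof.
move=> bI ctop; have /topP[cC adj] := ctop; have c_bounds := label_bounds cC.
case=> [[m [n shape_b]] | [r [_ lt_rk defN]] | [l shape_b]].
- exists n; last by right; exists m.
  have [m_gt0 lt_mn le_nk defN] := shape_b.
  rewrite leqNgt; apply/negP => lt_cn.
  have [|d dC defd] := @ex_label n.-1; first lia.
  have [x xC nadj] := ex_nonneighbor bI.
  have /setP/(_ d) := defN; have /setP/(_ x) := defN; have := label_bounds xC.
  rewrite !in_setU !in_interval !inE xC dC defd (negbTE nadj) adj ?defd //; lia.
- have [|d dC defd] := @ex_label #|C|; first lia.
  have /setP/(_ d) := defN; rewrite in_interval inE adj ?dC ?defd; lia.
- exists l; last by left.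
  have [_ _ defN] := shape_b.
  have /setP/(_ c) := defN; rewrite in_interval inE adj // cC => /esym; lia.
Qed.

Lemma segmented_iff_shapes :
  segmented <->
    [/\ (forall a, a \in I -> neighbors e a != set0 -> has_shape e C lab a),
        (forall a b r l, a \in I -> b \in I ->
           initial e C lab r a -> final e C lab l b -> r < l),
        (forall a b m n r, a \in I -> b \in I ->
           two_sided e C lab m n a -> initial e C lab r b -> r < n),
        (forall a b m n l, a \in I -> b \in I ->
           two_sided e C lab m n a -> final e C lab l b -> m < l)
      & (forall a b m n m' n', a \in I -> b \in I ->
           two_sided e C lab m n a -> two_sided e C lab m' n' b ->
           m < n' /\ m' < n)].
Proof.
split=> [seg | [shapes init_fin two_init two_fin two_two]].
  split.
  - by move=> a; apply: segmented_shape.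
  - move=> a b r l aI bI [_ lt_rk defa] [lt_1l _ defb].
    by apply: (segmented_endpoints seg aI bI); rewrite ?defa ?defb //; lia.
  - move=> a b m n r aI bI [_ lt_mn _ defa] [_ lt_rk defb].
    by apply: (segmented_endpoints seg bI aI); rewrite ?defa ?defb ?subsetUr //; lia.
  - move=> a b m n l aI bI [_ lt_mn le_nk defa] [lt_1l _ defb].
    by apply: (segmented_endpoints seg aI bI); rewrite ?defa ?defb ?subsetUl //; lia.
  - move=> a b m n m' n' aI bI [_ lt_mn le_nk defa] [_ lt_mn' le_nk' defb]; split.
      apply: (segmented_endpoints seg aI bI);
        by rewrite ?defa ?defb ?subsetUl ?subsetUr //; lia.
    apply: (segmented_endpoints seg bI aI);
      by rewrite ?defa ?defb ?subsetUl ?subsetUr //; lia.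
split=> [a aI | a b c aI bI cbot ctop].
  have [-> | nz] := eqVneq (neighbors e a) set0; first exact: sub0set.
  exact/shape_segments/shapes.
have shape_a : has_shape e C lab a.
  apply: shapes => //; apply/set0Pn; exists c; rewrite inE.
  by have /bottomP[cC] := cbot; apply.
have shape_b : has_shape e C lab b.
  apply: shapes => //; apply/set0Pn; exists c; rewrite inE.
  by have /topP[cC] := ctop; apply.
have [r le_cr end_a] := bottom_endpoint aI cbot shape_a.
have [l le_lc end_b] := top_endpoint bI ctop shape_b.
suff: r < l by rewrite ltnNge (leq_trans le_lc le_cr).
case: end_a end_b => [init_a | [n two_a]] [fin_b | [m two_b]].
- exact: init_fin init_a fin_b.
- exact: two_init two_b init_a.
- exact: two_fin two_a fin_b.
- by case: (two_two _ _ _ _ _ _ aI bI two_a two_b).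
Qed.

End Labeled.

Lemma orientable_iff_segmented :
  transitively_orientable e <-> exists lab, labeling C lab /\ segmented lab.
Proof.
split=> [[o [orient_o o_tr]] | [lab [labC seg]]].
  have [sub_o xor_o] := orient_o.
  have [//| x | x y xC yC neq_xy | lab labC o_lab] := @linear_order_labeling o.
  - by apply: contraFF (e_irr x) => /sub_o.
  - by have := xor_o x y (clique_adj xC yC neq_xy); do 2!case: (o _ _).
  exists lab; split=> //.
  exact: (orientation_segmented labC orient_o o_tr o_lab).
exists (segment_orientation lab); split.
  exact: segment_orientationP.
exact: segment_orientation_trans.
Qed.

End SplitGraph.

Theorem theorem5 (T : finType) (e : rel T) (I C : {set T})
    (e_sym : symmetric e) (e_irr : irreflexive e)
    (splitG : split_partition e I C) :
  transitively_orientable e <->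
  exists lab : T -> nat, labeling C lab /\
    [/\ (forall a, a \in I -> neighbors e a != set0 -> has_shape e C lab a),
        (forall a b r l, a \in I -> b \in I ->
           initial e C lab r a -> final e C lab l b -> r < l),
        (forall a b m n r, a \in I -> b \in I ->
           two_sided e C lab m n a -> initial e C lab r b -> r < n),
        (forall a b m n l, a \in I -> b \in I ->
           two_sided e C lab m n a -> final e C lab l b -> m < l)
      & (forall a b m n m' n', a \in I -> b \in I ->
           two_sided e C lab m n a -> two_sided e C lab m' n' b ->
           m < n' /\ m' < n)].
Proof.
rewrite (orientable_iff_segmented e_sym e_irr splitG).
by split=> -[lab [labC H]]; exists lab; split=> //;
  apply/(segmented_iff_shapes e_sym splitG labC).
Qed.
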